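(* Let $A$ be an irreducible Artin-Tits group of spherical type, let $a$ be an atom of $A$, let $x_a\in A$ be the fixed element associated to $a$ (with the properties recalled in the context), and let $w_a:=x_a^{390}$. Let $G$ be a subgroup of $A$ and let $S$ be a finite generating set of $G$. Suppose that there is a finite set $X\subset G$ such that for every $g\in G$ there exists $x\in X$ such that $g\cdot x$ is rigid and its normal form contains the subword $w_a$. Write $B(R):=B_{\Gamma(G,S)}(R)$ for the ball of radius $R$ centered at the identity in the Cayley graph $\Gamma(G,S)$. Then there are constants $\varepsilon,R_0>0$, depending on $S$, such that for all $R>R_0$, $$\frac{|\operatorname{Lox}(G,\mathcal{C}_{AL})\cap B(R)|}{|B(R)|}>\varepsilon .$$
   Context: **Artin-Tits groups.** Let $I$ be a finite set and $M=(m_{i,j})_{i,j\in I}$ a symmetric matrix with $m_{i,i}=1$ and $m_{i,j}\in\{2,3,\dots,\infty\}$ for $i\ne j$. The Artin-Tits group $A$ associated to $M$ has standard generators $\Sigma=\{\sigma_i\mid i\in I\}$ and relations $\sigma_i\sigma_j\sigma_i\cdots=\sigma_j\sigma_i\sigma_j\cdots$ ($m_{i,j}$ letters on each side) for all $i\neq j$ with $m_{i,j}\ne\infty$. The Coxeter group $W_A$ is the quotient of $A$ by the relations $\sigma_i^2=1$; $A$ is of spherical type if $W_A$ is finite, and irreducible if the graph on $\Sigma$ with an edge between $\sigma_i,\sigma_j$ whenever $m_{i,j}\geq3$ is connected. **Garside structure.** Let $\mathcal{P}\subset A$ be the submonoid generated by $\Sigma$. The prefix order is $a\preccurlyeq b\Leftrightarrow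 a^{-1}b\in\mathcal{P}$ and the suffix order is $a\succcurlyeq b\Leftrightarrow ab^{-1}\in\mathcal{P}$; both are lattice orders. Write $a\wedge b$ for the gcd for the prefix order and $a\wedge^{s} b$ for the greatest common suffix. Let $\Delta$ be the lcm of $\Sigma$ for $\preccurlyeq$ (the Garside element). Simple elements are the $a$ with $1\preccurlyeq a\preccurlyeq\Delta$; the atoms are the elements of $\Sigma$. For $x\in A$, $\inf(x)=\max\{k\in\mathbb{Z}\mid\Delta^k\preccurlyeq x\}$ and $\sup(x)=\min\{k\in\mathbb{Z}\mid x\preccurlyeq\Delta^k\}$. **Normal forms.** For simple $a,b$, the product $a\cdot b$ is in left normal form if $ab\wedge\Delta=a$, and in right normal form if $ab\wedge^{s}\Delta=b$. The left normal form of $x\in A$ is the unique expression $x=\Delta^kx_1\cdots x_r$ with $k\in\mathbb{Z}$, $x_i\notin\{1,\Delta\}$ simple, and each $x_i\cdot x_{i+1}$ in left normal form; the right normal form is the unique expression $x=x_1\cdots x_r\Delta^k$ with the $x_i\notin\{1,\Delta\}$ simple and each $x_i\cdot x_{i+1}$ in right normal form. Normal forms are always taken with respect to simple elements of $A$, irrespective of the generating set $S$ of $G$. ''Normal form'' without qualification means left normal form. **Rigidity.** For $x=\Delta^kx_1\cdots x_r$ in left normal form (with $r\ge1$), the initial factor is $\iota(x)=\Delta^kx_1\Delta^{-k}$ and the final factor is $\varphi(x)=x_r$; $x$ is rigid if $\varphi(x)\cdot\iota(x)$ is in left normal form. **Additional length graph $\mathcal{C}_{AL}=\mathcal{C}_{AL}(A)$.**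 An element $y\in A$ is absorbable if ($\inf(y)=0$ or $\sup(y)=0$) and there exists $x\in A$ with $\inf(xy)=\inf(x)$ and $\sup(xy)=\sup(x)$. The vertices are the cosets $g\langle\Delta\rangle$, $g\in A$; each vertex $v$ has a unique representative $\underline{v}\in v$ with $\inf(\underline{v})=0$. Two distinct vertices $v,w$ are joined by an edge (of length $1$) if and only if there exists either a simple element $m\notin\{1,\Delta\}$ with $\underline{v}m\in w$, or an absorbable $y$ with $\underline{v}y\in w$. This graph is connected and $\delta$-hyperbolic (known), and $A$ acts on it by isometries by left multiplication. **Loxodromic elements.** $g\in A$ acts loxodromically on $\mathcal{C}_{AL}$ if for some (equivalently any) vertex $v$ the map $n\mapsto g^nv$, $\mathbb{Z}\to\mathcal{C}_{AL}$, is a quasi-isometric embedding. $\operatorname{Lox}(G,\mathcal{C}_{AL})$ is the set of elements of $G$ acting loxodromically on $\mathcal{C}_{AL}$. **The elements $x_a$ and $w_a$ (known result of Calvez and Wiest, assumed).** For every atom $a$ of $A$ there is an element $x_a\in A$ such that: (i) $x_a$ acts loxodromically on $\mathcal{C}_{AL}$; (ii) the left and right normal forms of $x_a$ are the same (in particular $\inf(x_a)=0$) and $\iota(x_a)=\varphi(x_a)=a$; (iii) if $g\in A$ is rigid and its normal form contains the subword $w_a:=x_a^{390}$, then $g$ acts loxodromically on $\mathcal{C}_{AL}$. For each atom $a$ such an $x_a$ is fixed. ''The normal form of $g$ contains the subword $w_a$'' means that the sequence of simple factors of the left normal form of $w_a$ occurs as a block of consecutive factors in the left normal form of $g$. **Balls.**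 $B_{\Gamma(G,S)}(R)$ is the set of elements of $G$ that are products of at most $R$ elements of $S\cup S^{-1}$. *)

(* Defs.v *)
From HB Require Import structures.
From mathcomp Require Import all_boot all_order all_algebra.
From mathcomp Require Import finmap.
From mathcomp Require Import all_classical all_reals.

Set Implicit Arguments.
Unset Strict Implicit.
Unset Printing Implicit Defensive.

Local Open Scope quotient_scope.
Local Open Scope classical_set_scope.
Local Open Scope group_scope.

(* The letter (t, true) stands for the generator t, (t, false) for its
   inverse. *)
Notation word T := (seq (T * bool)).

Inductive word_eq (T : Type) (rel : word T -> word T -> Prop) :
    word T -> word T -> Prop :=
| word_eq_refl u : word_eq rel u u
| word_eq_sym u v : word_eq rel u v -> word_eq rel v u
| word_eq_trans u v w : word_eq rel u v -> word_eq rel v w -> word_eq rel u w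
| word_eq_cancel (p q : word T) t b :
    word_eq rel (p ++ [:: (t, b); (t, ~~ b)] ++ q) (p ++ q)
| word_eq_rel (p q u v : word T) :
    rel u v -> word_eq rel (p ++ u ++ q) (p ++ v ++ q).

Lemma word_eq_cat (T : Type) (rel : word T -> word T -> Prop)
    (u u' v v' : word T) :
  word_eq rel u u' -> word_eq rel v v' -> word_eq rel (u ++ v) (u' ++ v').
Proof.
move=> uu' vv'; apply: (@word_eq_trans _ _ _ (u' ++ v)).
- elim: uu' => {u u'} [u|u w _ /word_eq_sym //|u w z _ + _|p q t b|p q u w r].
  + exact: word_eq_refl.
  + exact: word_eq_trans.
  + by rewrite -!catA; apply: word_eq_cancel.
  + by rewrite -!catA; apply: word_eq_rel.
- elim: vv' => {v v'} [v|v w _ /word_eq_sym //|v w z _ + _|p q t b|p q v w r].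
  + exact: word_eq_refl.
  + exact: word_eq_trans.
  + by rewrite !(catA u'); apply: word_eq_cancel.
  + by rewrite !(catA u'); apply: word_eq_rel.
Qed.

Definition word_inv (T : Type) (u : word T) : word T :=
  rev [seq (x.1, ~~ x.2) | x <- u].

Lemma word_inv_cat (T : Type) (u v : word T) :
  word_inv (u ++ v) = word_inv v ++ word_inv u.
Proof. by rewrite /word_inv map_cat rev_cat. Qed.

Lemma word_invK (T : Type) : involutive (@word_inv T).
Proof.
move=> u; rewrite /word_inv map_rev revK -map_comp -[RHS]map_id.
by apply: eq_map => -[t b] /=; rewrite negbK.
Qed.

Lemma word_eq_mulVw (T : Type) (rel : word T -> word T -> Prop) (u : word T) :
  word_eq rel (word_inv u ++ u) [::].
Proof.
elim: u => [|[t b] u IH]; first exact: word_eq_refl.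
rewrite -cat1s word_inv_cat -catA; apply: word_eq_trans IH.
by have := word_eq_cancel rel (word_inv u) u t (~~ b); rewrite negbK.
Qed.

Lemma word_eq_mulwV (T : Type) (rel : word T -> word T -> Prop) (u : word T) :
  word_eq rel (u ++ word_inv u) [::].
Proof. by rewrite -{1}[u]word_invK; apply: word_eq_mulVw. Qed.

Lemma word_eq_inv (T : Type) (rel : word T -> word T -> Prop) (u v : word T) :
  word_eq rel u v -> word_eq rel (word_inv u) (word_inv v).
Proof.
move=> uv; apply: (@word_eq_trans _ _ _ (word_inv u ++ (v ++ word_inv v))).
  rewrite -{1}[word_inv u]cats0; apply: word_eq_cat; first exact: word_eq_refl.
  exact/word_eq_sym/word_eq_mulwV.
rewrite catA -[X in word_eq _ _ X]cat0s; apply: word_eq_cat.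
  apply: word_eq_trans (word_eq_mulVw rel u).
  by apply: word_eq_cat; [apply: word_eq_refl | apply: word_eq_sym].
exact: word_eq_refl.
Qed.

Definition word_eqb (T : choiceType) (rel : word T -> word T -> Prop)
  (u v : word T) : bool := `[< word_eq rel u v >].

Lemma word_eqb_refl (T : choiceType) (rel : word T -> word T -> Prop) :
  reflexive (word_eqb rel).
Proof. by move=> u; apply/asboolP/word_eq_refl. Qed.

Lemma word_eqb_sym (T : choiceType) (rel : word T -> word T -> Prop) :
  symmetric (word_eqb rel).
Proof. by move=> u v; apply/asboolP/asboolP => /word_eq_sym. Qed.

Lemma word_eqb_trans (T : choiceType) (rel : word T -> word T -> Prop) :
  transitive (word_eqb rel).
Proof.
by move=> v u w /asboolP uv /asboolP vw; apply/asboolP/(word_eq_trans uv).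
Qed.

Canonical word_equiv (T : choiceType) (rel : word T -> word T -> Prop) :=
  EquivRel (word_eqb rel) (@word_eqb_refl T rel) (@word_eqb_sym T rel)
    (@word_eqb_trans T rel).

Definition presented (T : choiceType) (rel : word T -> word T -> Prop) : Type :=
  {eq_quot word_equiv rel}.

HB.instance Definition _ (T : choiceType) (rel : word T -> word T -> Prop) :=
  Choice.on (presented rel).

Definition pclass (T : choiceType) (rel : word T -> word T -> Prop)
  (u : word T) : presented rel := \pi_{eq_quot word_equiv rel} u.

Definition prepr (T : choiceType) (rel : word T -> word T -> Prop)
  (x : presented rel) : word T := repr (x : {eq_quot word_equiv rel}).

Lemma pclassP (T : choiceType) (rel : word T -> word T -> Prop) (u v : word T) :
  pclass rel u = pclass rel v <-> word_eq rel u v.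
Proof.
split=> [/eqmodP/asboolP //|uv].
by apply/eqmodP/asboolP.
Qed.

Lemma preprK (T : choiceType) (rel : word T -> word T -> Prop) :
  cancel (@prepr T rel) (pclass rel).
Proof. exact: reprK. Qed.

Definition pmul (T : choiceType) (rel : word T -> word T -> Prop)
  (x y : presented rel) : presented rel := pclass rel (prepr x ++ prepr y).

Definition pinv (T : choiceType) (rel : word T -> word T -> Prop)
  (x : presented rel) : presented rel := pclass rel (word_inv (prepr x)).

Lemma prepr_class (T : choiceType) (rel : word T -> word T -> Prop)
  (u : word T) : word_eq rel (prepr (pclass rel u)) u.
Proof. by apply/pclassP; rewrite preprK. Qed.

Lemma pmul_class (T : choiceType) (rel : word T -> word T -> Prop)
  (u v : word T) : pmul (pclass rel u) (pclass rel v) = pclass rel (u ++ v).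
Proof. by apply/pclassP/word_eq_cat; apply: prepr_class. Qed.

Lemma pinv_class (T : choiceType) (rel : word T -> word T -> Prop)
  (u : word T) : pinv (pclass rel u) = pclass rel (word_inv u).
Proof. exact/pclassP/word_eq_inv/prepr_class. Qed.

Lemma pmulA (T : choiceType) (rel : word T -> word T -> Prop) :
  associative (@pmul T rel).
Proof.
move=> x y z; rewrite -(preprK x) -(preprK y) -(preprK z).
by rewrite !pmul_class catA.
Qed.

Lemma pmul1 (T : choiceType) (rel : word T -> word T -> Prop) :
  left_id (pclass rel [::]) (@pmul T rel).
Proof. by move=> x; rewrite -(preprK x) pmul_class. Qed.

Lemma pmulr1 (T : choiceType) (rel : word T -> word T -> Prop) :
  right_id (pclass rel [::]) (@pmul T rel).
Proof. by move=> x; rewrite -(preprK x) pmul_class cats0. Qed.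

Lemma pmulVg (T : choiceType) (rel : word T -> word T -> Prop) :
  left_inverse (pclass rel [::]) (@pinv T rel) (@pmul T rel).
Proof.
move=> x; rewrite -(preprK x) pinv_class pmul_class.
exact/pclassP/word_eq_mulVw.
Qed.

Lemma pmulgV (T : choiceType) (rel : word T -> word T -> Prop) :
  right_inverse (pclass rel [::]) (@pinv T rel) (@pmul T rel).
Proof.
move=> x; rewrite -(preprK x) pinv_class pmul_class.
exact/pclassP/word_eq_mulwV.
Qed.

HB.instance Definition _ (T : choiceType) (rel : word T -> word T -> Prop) :=
  isGroup.Build (presented rel) (@pmulA T rel) (@pmul1 T rel) (@pmulr1 T rel)
    (@pmulVg T rel) (@pmulgV T rel).

Definition gpow (G : groupType) (x : G) (k : int) : G :=
  match k with Posz n => x ^+ n | Negz n => x ^- n.+1 end.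

Definition subgroup (G : groupType) : set (set G) :=
  [set H | H 1 /\ forall x y, H x -> H y -> H (x * y^-1)].

Definition generated (G : groupType) (S : set G) : set G :=
  smallest (@subgroup G) S.

Definition ball_S (R : realType) (G : groupType) (S : set G) (r : R) : set G :=
  [set g | exists s : seq G,
     [/\ forall x, x \in s -> (S `|` [set y^-1 | y in S]) x,
         ((size s)%:R <= r)%R & g = \prod_(x <- s) x]].

(* None encodes the value infinity. *)
Definition coxeter_matrix (I : finType) (M : I -> I -> option nat) : Prop :=
  [/\ forall i j, M i j = M j i,
      forall i, M i i = Some 1%N
    & forall i j n, i != j -> M i j = Some n -> (2 <= n)%N].

Definition alternating (I : finType) (i j : I) (n : nat) : word I :=
  mkseq (fun k => (if odd k then j else i, true)) n.

Inductive artin_rel (I : finType) (M : I -> I -> option nat) :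
    word I -> word I -> Prop :=
| Artin_rel i j n : i != j -> M i j = Some n ->
    artin_rel M (alternating i j n) (alternating j i n).

Inductive coxeter_rel (I : finType) (M : I -> I -> option nat) :
    word I -> word I -> Prop :=
| Coxeter_artin u v : artin_rel M u v -> coxeter_rel M u v
| Coxeter_square i : coxeter_rel M [:: (i, true); (i, true)] [::].

Definition artin (I : finType) (M : I -> I -> option nat) : groupType :=
  presented (artin_rel M).

(* Adding the relators sigma_i^2 to the presentation of the Artin-Tits group
   presents its quotient by the relations sigma_i^2 = 1. *)
Definition coxeter (I : finType) (M : I -> I -> option nat) : groupType :=
  presented (coxeter_rel M).

Definition spherical (I : finType) (M : I -> I -> option nat) : Prop :=
  finite_set [set: coxeter M].

Definition coxeter_edge (I : finType) (M : I -> I -> option nat) : rel I :=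
  fun i j => (i != j) && (if M i j is Some n then 3 <= n else true)%N.

Definition irreducible (I : finType) (M : I -> I -> option nat) : Prop :=
  forall i j, connect (coxeter_edge M) i j.

(* The maxima, minima, lattice operations and normal forms below are selected
   by xget, which returns its first argument when there is nothing to select.
   They all exist, and are unique, when M is a Coxeter matrix of spherical
   type. *)

Definition sigma (I : finType) (M : I -> I -> option nat) (i : I) : artin M :=
  pclass (artin_rel M) [:: (i, true)].

Definition atoms (I : finType) (M : I -> I -> option nat) : set (artin M) :=
  range (@sigma I M).

Definition positive (I : finType) (M : I -> I -> option nat) : set (artin M) :=
  [set x | exists s : seq I, x = \prod_(i <- s) sigma M i].

Definition prefix_le (I : finType) (M : I -> I -> option nat)
  (a b : artin M) : Prop := positive (a^-1 * b).

Definition suffix_ge (I : finType) (M : I -> I -> option nat)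
  (a b : artin M) : Prop := positive (a * b^-1).

Definition prefix_gcd (I : finType) (M : I -> I -> option nat)
    (a b : artin M) : artin M :=
  xget 1 [set d | [/\ prefix_le d a, prefix_le d b &
    forall c, prefix_le c a -> prefix_le c b -> prefix_le c d]].

Definition suffix_gcd (I : finType) (M : I -> I -> option nat)
    (a b : artin M) : artin M :=
  xget 1 [set d | [/\ suffix_ge a d, suffix_ge b d &
    forall c, suffix_ge a c -> suffix_ge b c -> suffix_ge d c]].

Definition Delta (I : finType) (M : I -> I -> option nat) : artin M :=
  xget 1 [set d | (forall a, atoms a -> prefix_le a d) /\
    forall c, (forall a, atoms a -> prefix_le a c) -> prefix_le d c].

Definition simple (I : finType) (M : I -> I -> option nat) (a : artin M) :
  Prop := prefix_le 1 a /\ prefix_le a (Delta M).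

Definition proper_simple (I : finType) (M : I -> I -> option nat)
  (a : artin M) : Prop := [/\ simple a, a <> 1 & a <> Delta M].

Definition ginf (I : finType) (M : I -> I -> option nat) (x : artin M) : int :=
  xget 0%R [set k : int | prefix_le (gpow (Delta M) k) x /\
    forall j : int, prefix_le (gpow (Delta M) j) x -> (j <= k)%R].

Definition gsup (I : finType) (M : I -> I -> option nat) (x : artin M) : int :=
  xget 0%R [set k : int | prefix_le x (gpow (Delta M) k) /\
    forall j : int, prefix_le x (gpow (Delta M) j) -> (k <= j)%R].

Definition left_normal_pair (I : finType) (M : I -> I -> option nat)
    (a b : artin M) : Prop :=
  [/\ simple a, simple b & prefix_gcd (a * b) (Delta M) = a].

Definition right_normal_pair (I : finType) (M : I -> I -> option nat)
    (a b : artin M) : Prop :=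
  [/\ simple a, simple b & suffix_gcd (a * b) (Delta M) = b].

(* x = Delta^k x_1 ... x_r is encoded as (k, [:: x_1; ...; x_r]). *)
Definition is_left_nf (I : finType) (M : I -> I -> option nat) (x : artin M)
    (f : int * seq (artin M)) : Prop :=
  [/\ x = gpow (Delta M) f.1 * \prod_(y <- f.2) y,
      forall y, y \in f.2 -> proper_simple y
    & forall i, (i.+1 < size f.2)%N ->
        left_normal_pair (nth 1 f.2 i) (nth 1 f.2 i.+1)].

(* x = x_1 ... x_r Delta^k is encoded as ([:: x_1; ...; x_r], k). *)
Definition is_right_nf (I : finType) (M : I -> I -> option nat) (x : artin M)
    (f : seq (artin M) * int) : Prop :=
  [/\ x = (\prod_(y <- f.1) y) * gpow (Delta M) f.2,
      forall y, y \in f.1 -> proper_simple y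
    & forall i, (i.+1 < size f.1)%N ->
        right_normal_pair (nth 1 f.1 i) (nth 1 f.1 i.+1)].

Definition left_nf (I : finType) (M : I -> I -> option nat) (x : artin M) :
  int * seq (artin M) := xget (0%R, [::]) [set f | is_left_nf x f].

Definition right_nf (I : finType) (M : I -> I -> option nat) (x : artin M) :
  seq (artin M) * int := xget ([::], 0%R) [set f | is_right_nf x f].

(* The initial and final factors are meaningful only if x is not a power of
   Delta. *)
Definition initial_factor (I : finType) (M : I -> I -> option nat)
    (x : artin M) : artin M :=
  gpow (Delta M) (left_nf x).1 * head 1 (left_nf x).2
    * (gpow (Delta M) (left_nf x).1)^-1.

Definition final_factor (I : finType) (M : I -> I -> option nat)
  (x : artin M) : artin M := last 1 (left_nf x).2.

Definition rigid (I : finType) (M : I -> I -> option nat) (x : artin M) :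
  Prop := (left_nf x).2 <> [::] /\
    left_normal_pair (final_factor x) (initial_factor x).

Definition nf_contains (I : finType) (M : I -> I -> option nat)
  (g w : artin M) : Prop := infix (left_nf w).2 (left_nf g).2.

Definition absorbable (I : finType) (M : I -> I -> option nat) (y : artin M) :
    Prop :=
  (ginf y = 0%R \/ gsup y = 0%R) /\
  exists x, ginf (x * y) = ginf x /\ gsup (x * y) = gsup x.

Definition Delta_coset (I : finType) (M : I -> I -> option nat)
    (g : artin M) : set (artin M) :=
  range (fun k : int => g * gpow (Delta M) k).

Definition AL_vertex (I : finType) (M : I -> I -> option nat) :
  set (set (artin M)) := range (@Delta_coset I M).

Definition vertex_repr (I : finType) (M : I -> I -> option nat)
  (v : set (artin M)) : artin M := xget 1 [set x | v x /\ ginf x = 0%R].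

(* A symmetric relation when M is of spherical type: the case of w is
   recovered from that of v by a complement of m, resp. by y^-1, up to
   conjugation by a power of Delta. *)
Definition AL_edge (I : finType) (M : I -> I -> option nat)
    (v w : set (artin M)) : Prop :=
  [/\ AL_vertex v, AL_vertex w, v <> w &
    (exists m, proper_simple m /\ w (vertex_repr v * m)) \/
    (exists y, absorbable y /\ w (vertex_repr v * y))].

Fixpoint walk (V : Type) (E : V -> V -> Prop) (n : nat) (v w : V) : Prop :=
  if n is m.+1 then exists2 u, E v u & walk E m u w else v = w.

Definition graph_dist (V : Type) (E : V -> V -> Prop) (v w : V) : nat :=
  xget 0%N [set n | walk E n v w /\ forall m, walk E m v w -> (n <= m)%N].

Definition translate (G : groupType) (g : G) (v : set G) : set G :=
  [set g * x | x in v].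

Definition qi_embedding (R : realType) (X Y : Type)
    (dX : X -> X -> R) (dY : Y -> Y -> R) (f : X -> Y) : Prop :=
  exists L C : R, [/\ (1 <= L)%R, (0 <= C)%R & forall x y,
    (L^-1 * dX x y - C <= dY (f x) (f y) <= L * dX x y + C)%R].

Definition loxodromic (R : realType) (I : finType) (M : I -> I -> option nat)
    (g : artin M) : Prop :=
  exists2 v, AL_vertex v &
    qi_embedding (fun m n : int => `|m - n|%:~R : R)%R
      (fun v w => (graph_dist (@AL_edge I M) v w)%:R : R)%R
      (fun n : int => translate (gpow g n) v).

Definition Lox (R : realType) (I : finType) (M : I -> I -> option nat)
  (G : set (artin M)) : set (artin M) := [set g | G g /\ loxodromic R g].

Definition w_of (I : finType) (M : I -> I -> option nat) (x : artin M) :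
  artin M := x ^+ 390.

Definition is_x_of_atom (R : realType) (I : finType)
    (M : I -> I -> option nat) (a x : artin M) : Prop :=
  [/\ loxodromic R x,
      exists s, [/\ left_nf x = (0%R, s), right_nf x = (s, 0%R), s <> [::],
                    initial_factor x = a & final_factor x = a]
    & forall g, rigid g -> nf_contains g (w_of x) -> loxodromic R g].

(* Main.v *)
Require Import Defs.
From HB Require Import structures.
From mathcomp Require Import all_boot all_order all_algebra.
From mathcomp Require Import finmap.
From mathcomp Require Import all_classical all_reals.

(** The geometry is contained in the choice of [x_a]: every rigid element whose
    normal form contains [w_a] is loxodromic.  The hypothesis on [X] thus says
    that each [g] in [G] becomes loxodromic after right multiplication by a
    suitable [x] in the finite set [X], and what remains is a counting argument.

    It applies to any group with a finite generating set [S]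
    ([ball_density]).  Choose [L] such that [X] lies in the ball [B(L)].  For
    [r > L], correcting the elements of [B(r - L)] by elements of [X] produces
    good elements of [B(r)], and at most [|X|] elements of [B(r - L)] lead to
    the same one.  Moreover [B(r)] is covered by the products of [B(r - L)] and
    [B(L)], because a word of length at most [r] can be cut [L] letters before
    its end.  Hence, if [P] is the set of good elements,
      [|B(r)| <= |B(r - L)| * |B(L)| <= |P `&` B(r)| * |X| * |B(L)|],
    and the proportion of good elements is bounded below by a positive constant
    that does not depend on [r]. *)

Import Order.TTheory GRing.Theory Num.Theory.

Local Open Scope classical_set_scope.
Local Open Scope ring_scope.

Lemma leq_card_image2 (T U V : choiceType) (f : T -> U -> V)
    (A : set T) (B : set U) (C : set V) :
  finite_set A -> finite_set B -> C `<=` [set f x y | x in A & y in B] ->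
  (#|` fset_set C| <= #|` fset_set A| * #|` fset_set B|)%fset%N.
Proof.
move=> finA finB CAB.
have finC : finite_set C by apply: sub_finite_set CAB _; apply: finite_image2.
rewrite -(size_allpairs f); apply: uniq_leq_size (fset_uniq _) _ => z.
rewrite in_fset_set // inE => /CAB [x Ax [y By <-]].
by apply: allpairs_f; rewrite in_fset_set // inE.
Qed.

Section Balls.
Variables (R : realType) (H : groupType) (S : set H).
Implicit Types (r q : R) (g h : H).

Lemma ball_S1 r : 0 <= r -> ball_S S r 1%g.
Proof. by move=> r0; exists [::]; split; rewrite ?big_nil. Qed.

Lemma sub_ball_S r q : r <= q -> ball_S S r `<=` ball_S S q.
Proof. by move=> rq g [s [Ss sr ->]]; exists s; split=> //; apply: le_trans rq. Qed.

Lemma ball_SM r q g h :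
  ball_S S r g -> ball_S S q h -> ball_S S (r + q) (g * h)%g.
Proof.
move=> [s [Ss sr ->]] [t [St tq ->]]; exists (s ++ t); split.
- by move=> x; rewrite mem_cat => /orP[/Ss|/St].
- by rewrite size_cat natrD lerD.
- by rewrite big_cat.
Qed.

Lemma ball_SV r g : ball_S S r g -> ball_S S r g^-1%g.
Proof.
move=> [s [Ss sr ->]]; exists (rev [seq x^-1%g | x <- s]); split.
- move=> _ /[!mem_rev] /mapP[x /Ss [Sx|[y Sy <-]] ->].
    by right; exists x.
  by left; rewrite invgK.
- by rewrite size_rev size_map.
- elim: s {Ss sr} => [|x s IH]; first by rewrite /= !big_nil invg1.
  by rewrite big_cons invgM IH /= rev_cons -cats1 big_cat big_seq1.
Qed.

Lemma ball_S_sub_subgroup (G : set H) r :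
  subgroup G -> S `<=` G -> ball_S S r `<=` G.
Proof.
move=> [G1 GD] SG g [s [Ss _ ->]].
have GV x : G x -> G x^-1%g by move=> Gx; rewrite -[x^-1%g]mul1g; apply: GD.
elim: s Ss => [|x s IH] Ss; first by rewrite big_nil.
rewrite big_cons -[X in (_ * X)%g]invgK; apply: GD.
  by case: (Ss x (mem_head _ _)) => [/SG //|[y /SG/GV + <-]].
by apply/GV/IH => y ys; apply: Ss; rewrite inE ys orbT.
Qed.

(** The union of all balls is a subgroup containing [S]. *)
Lemma generated_ball_S g : generated S g -> exists n : nat, ball_S S (n%:R : R) g.
Proof.
apply: (@smallest_sub _ _ _ [set g | exists n : nat, ball_S S (n%:R : R) g]).
- split=> [|x y [m Bx] [n By]]; first by exists 0; apply: ball_S1.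
  by exists (m + n)%N; rewrite natrD; apply: ball_SM => //; apply: ball_SV.
- move=> x Sx; exists 1; exists [:: x]; split; rewrite ?big_seq1 //.
  by move=> y /[!inE] /eqP ->; left.
Qed.

Lemma finite_sub_ball_S (X : set H) :
  finite_set X -> X `<=` generated S ->
  exists n : nat, X `<=` ball_S S (n%:R : R).
Proof.
move=> finX XS.
have /choice[n Bn] g : exists n : nat, generated S g -> ball_S S (n%:R : R) g.
  have [/generated_ball_S[n]|] := pselect (generated S g); first by exists n.
  by exists 0.
exists (\max_(x <- fset_set X) n x)%N => x Xx.
apply: sub_ball_S (Bn x (XS x Xx)); rewrite ler_nat.
by apply: leq_bigmax_seq; rewrite // in_fset_set // inE.
Qed.

Lemma finite_ball_S r : finite_set S -> finite_set (ball_S S r).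
Proof.
move=> finS.
have finB (n : nat) : finite_set (ball_S S (n%:R : R)).
  elim: n => [|n IHn].
    apply: (sub_finite_set _ (finite_set1 1%g)) => g [s [_ + ->]].
    by rewrite ler_nat leqn0 => /nilP ->; rewrite big_nil.
  have finSV : finite_set (1%g |` (S `|` [set y^-1%g | y in S])).
    by rewrite !finite_setU; split=> //; split=> //; apply: finite_image.
  apply: sub_finite_set (finite_image2 (fun g h => g * h)%g finSV IHn).
  move=> _ [[|x s] [Ss sn ->]].
    by exists 1%g; [left | exists 1%g; rewrite ?mulg1 ?big_nil //; apply: ball_S1].
  exists x; first by right; apply: Ss; rewrite mem_head.
  exists (\prod_(y <- s) y)%g; last by rewrite big_cons.
  exists s; split=> [y ys||//]; first by apply: Ss; rewrite inE ys orbT.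
  by move: sn; rewrite !ler_nat.
apply: sub_finite_set (finB (Num.bound r)).
exact/sub_ball_S/ltW/unstable.ltr_bound.
Qed.

(** The cut is made [n] letters before the end of a word, or at its start if it
    is shorter, so that [r] need not be an integer. *)
Lemma ball_S_split r (n : nat) : n%:R <= r ->
  ball_S S r `<=` [set (g * h)%g | g in ball_S S (r - n%:R) & h in ball_S S (n%:R : R)].
Proof.
move=> nr _ [s [Ss sr ->]].
exists (\prod_(x <- take (size s - n) s) x)%g.
  exists (take (size s - n) s); split=> [x /mem_take/Ss //||//].
  rewrite size_takel ?leq_subr //; have [sn|/ltnW ns] := leqP (size s) n.
    by move: sn; rewrite -subn_eq0 => /eqP ->; rewrite subr_ge0.
  by rewrite natrB // lerB.
exists (\prod_(x <- drop (size s - n) s) x)%g.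
  exists (drop (size s - n) s); split=> [x /mem_drop/Ss //||//].
  by rewrite size_drop ler_nat leq_subCl.
by rewrite -big_cat cat_take_drop.
Qed.

(** A set that meets [g X] for every [g], with [X] finite, has positive
    density in balls: [g] is recovered from the point [g * x] of [P] and from
    [x] in [X]. *)
Theorem ball_density (X P : set H) :
  finite_set S -> finite_set X -> X `<=` generated S ->
  (forall g, generated S g -> exists2 x, X x & P (g * x)%g) ->
  exists eps r0 : R, [/\ 0 < eps, 0 < r0 & forall r, r0 < r ->
    eps < #|` fset_set (P `&` ball_S S r)|%fset%:R /
          #|` fset_set (ball_S S r)|%fset%:R].
Proof.
move=> finS finX XS HX.
have [n Xn] := finite_sub_ball_S _ finX XS.
pose K := (#|` fset_set X| * #|` fset_set (ball_S S (n%:R : R))|)%fset%N.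
have finB r : finite_set (ball_S S r) by apply: finite_ball_S.
(* [p / b] is at least [1 / K]; [K.+1] makes the bound strict. *)
exists K.+1%:R^-1, n.+1%:R; split; rewrite ?invr_gt0 ?ltr0n // => r nr.
have {}nr : n%:R <= r by apply: le_trans (ltW nr); rewrite ler_nat.
have finPB : finite_set (P `&` ball_S S r) by apply: finite_setIr.
set p := #|` fset_set (P `&` ball_S S r)|%fset.
set b := #|` fset_set (ball_S S r)|%fset.
have b_gt0 : (0 < b)%N.
  rewrite cardfs_gt0; apply/fset0Pn; exists 1%g.
  by rewrite in_fset_set // inE; apply/ball_S1/le_trans/nr.
have b_le : (b <= p * K)%N.
  have /leq_trans := leq_card_image2 _ _ _ _ _ _ _ (finB _) (finB _)
    (ball_S_split _ _ nr).
  apply.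
  rewrite /K mulnA leq_mul2r; apply/orP; right.
  apply: (leq_card_image2 _ _ _ (fun g x => g * x^-1)%g) => // g Bg.
  have gS : generated S g.
    move=> G [sG SG]; exact: (ball_S_sub_subgroup _ _ sG SG _ Bg).
  have [x Xx Pgx] := HX g gS.
  exists (g * x)%g; last by exists x; rewrite ?mulgK.
  by split=> //; rewrite -[r](subrK n%:R); apply/ball_SM/Xn.
have p_gt0 : (0 < p)%N.
  by move: (leq_trans b_gt0 b_le); rewrite muln_gt0 => /andP[].
rewrite ltr_pdivlMr ?ltr0n // ltr_pdivrMl ?ltr0n // -natrM ltr_nat.
by rewrite mulSn mulnC -add1n leq_add.
Qed.

End Balls.

Theorem lemma8 (R : realType) (I : finType) (M : I -> I -> option nat)
    (HM : coxeter_matrix M) (Hirr : irreducible M) (Hsph : spherical M)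
    (a xa : artin M) (Ha : atoms a) (Hxa : is_x_of_atom R a xa)
    (G : set (artin M)) (HG : subgroup G)
    (S : set (artin M)) (HSfin : finite_set S) (HS : generated S = G)
    (X : set (artin M)) (HXfin : finite_set X) (HXG : X `<=` G)
    (HX : forall g, G g -> exists2 x, X x &
       rigid (g * x)%g /\ nf_contains (g * x)%g (w_of xa)) :
  exists eps R0 : R, [/\ 0 < eps, 0 < R0 &
    forall r : R, R0 < r ->
      (#|` fset_set (Lox R G `&` ball_S S r)|)%fset%:R /
      (#|` fset_set (ball_S S r)|)%fset%:R > eps].
Proof.
have [_ _ lox_w] := Hxa; case: HG => G1 GD.
have GM x y : G x -> G y -> G (x * y)%g.
  move=> Gx Gy; rewrite -[y]invgK; apply: (GD _ _ Gx).
  by rewrite -[y^-1%g]mul1g; apply: GD.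
apply: (ball_density _ _ _ X) => //; rewrite HS // => g Gg.
have [x Xx [rig_gx gx_w]] := HX g Gg.
by exists x => //; split; [apply: GM => //; apply: HXG | apply: lox_w].
Qed.
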